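(* There exists a spectacular complex; more precisely, there is a spectacular complex $K$ whose 1-skeleton has girth $15$ and which has exactly $28$ polygons, each of which is a $35$-gon.
   Context: A spectacular complex is a finite 2-dimensional CW-complex $K$ (its 1-cells are called edges, its 2-cells polygons) such that: (1) the 1-skeleton $K^1$ is a simplicial graph; (2) the attaching map of each polygon $P$ is an embedding of the boundary circle $\partial P$ into $K^1$; (3) every edge path between distinct vertices of $K^1$ of valence at least three has length at least 5; (4) the girth $g$ of $K^1$ (minimal length of a cycle) is at least 13; (5) the perimeter $l_P$ (number of edges of $\partial P$) of each polygon $P$ satisfies $l_P>2g$; (6) for each pair $P\ne Q$ of polygons, each component of $\partial P\cap\partial Q$ contains strictly fewer than $\min\{l_P/6,l_Q/6\}$ edges; (7) $K$ is acyclic (has the integral homology of a point). *)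

(* Defs.v *)
From HB Require Import structures.
From mathcomp Require Import all_boot all_order all_algebra.

Set Implicit Arguments.
Unset Strict Implicit.
Unset Printing Implicit Defensive.

Import GRing.Theory.
Local Open Scope ring_scope.

Section Graph.
Variables (V : finType) (adj : rel V).

(* A cycle of a simplicial graph, listed by its successive vertices; its
   length [size c] is also its number of edges. *)
Definition graph_cycle (c : seq V) : bool :=
  [&& (2 < size c)%N, path.cycle adj c & uniq c].

Definition valence (x : V) : nat := #|[set y | adj x y]|.

Definition is_girth (g : nat) : Prop :=
  (exists c, graph_cycle c /\ size c = g) /\
  (forall c, graph_cycle c -> (g <= size c)%N).

End Graph.

(* Finite CW-complexes of dimension at most 2 whose 1-skeleton is a simplicial
   graph and whose 2-cells are attached along embedded circles.  Up to
   cell-preserving homeomorphism, such a complex is given by its graph and, for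
   each polygon, the cycle of the graph onto which its boundary is mapped.  The
   base point and direction of the list [bd P] are a choice of orientation.
   Distinct polygons may have the same boundary. *)
Record polygonal_complex := PolygonalComplex {
  vertex : finType;
  adj : rel vertex;
  adj_sym : symmetric adj;
  adj_irr : irreflexive adj;
  polygon : finType;
  bd : polygon -> seq vertex;
  bd_cycle : forall P : polygon, graph_cycle adj (bd P)
}.

Section Complex.
Variable K : polygonal_complex.
Local Notation V := (vertex K).
Local Notation F := (polygon K).

Definition perimeter (P : F) : nat := size (bd P).

Definition bd_step (P : F) : rel V :=
  fun x y => (x \in bd P) && (next (bd P) x == y).

Definition bd_edge (P : F) : rel V :=
  fun x y => bd_step P x y || bd_step P y x.

Definition common_edge (P Q : F) : rel V :=
  fun x y => bd_edge P x y && bd_edge Q x y.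

(* The edges, as unordered pairs of vertices, of the component of x in the
   intersection of the boundaries of P and Q. *)
Definition component_edges (P Q : F) (x : V) : {set {set V}} :=
  [set [set u.1; u.2] | u : V * V
     & connect (common_edge P Q) x u.1 && common_edge P Q u.1 u.2].

(* Cellular chains.  A 1-chain is an alternating function on ordered pairs of
   vertices, supported on edges: f (x, y) is the coefficient of the edge
   oriented from x to y, so that no orientation of the edges is chosen. *)
Definition chain0 := {ffun V -> int}.
Definition chain2 := {ffun F -> int}.

Definition is_chain1 (f : {ffun V * V -> int}) : Prop :=
  (forall x y, f (x, y) = - f (y, x)) /\
  (forall x y, ~~ adj x y -> f (x, y) = 0).

(* The boundary of the edge oriented from x to y is y - x. *)
Definition d1 (f : {ffun V * V -> int}) : chain0 :=
  [ffun y => \sum_(x : V) f (x, y)].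

Definition d2 (a : chain2) : {ffun V * V -> int} :=
  [ffun u => \sum_(P : F)
     a P * ((bd_step P u.1 u.2)%:R - (bd_step P u.2 u.1)%:R)].

Definition is_boundary0 (c : chain0) : Prop :=
  exists2 f, is_chain1 f & d1 f = c.

(* H_0 = chain0 / im d1 is isomorphic to Z, H_1 = ker d1 / im d2 = 0 and
   H_2 = ker d2 = 0. *)
Definition acyclic : Prop :=
  [/\ exists phi : {additive chain0 -> int},
        (forall m : int, exists c, phi c = m) /\
        (forall c, phi c = 0 <-> is_boundary0 c),
      forall f, is_chain1 f -> d1 f = 0 -> exists a, d2 a = f
    & forall a, d2 a = 0 -> a = 0].

(* The first clause excludes complexes of dimension less than 2; since it
   provides a cycle, the girth is finite.  The inequality with
   min(l_P / 6, l_Q / 6) is multiplied out by 6. *)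
Definition spectacular : Prop :=
  (0 < #|F|)%N /\
  (forall (x y : V) (p : seq V),
     x != y -> (3 <= valence (@adj K) x)%N -> (3 <= valence (@adj K) y)%N ->
     path (@adj K) x p -> last x p = y -> (5 <= size p)%N) /\
  (exists g : nat,
     [/\ is_girth (@adj K) g, (13 <= g)%N
       & forall P : F, (2 * g < perimeter P)%N]) /\
  (forall (P Q : F) (x : V),
     P != Q -> x \in bd P -> x \in bd Q ->
     (6 * #|component_edges P Q x| < minn (perimeter P) (perimeter Q))%N) /\
  acyclic.

End Complex.

(* Main.v *)
Require Import Defs.
From HB Require Import structures.
From mathcomp Require Import all_boot all_order all_algebra.
From mathcomp Require Import zify ring.

(* Subdivide each edge of the complete graph K_9 into 5 edges and attach
   9 - 36 + 28 = 1, hence 28, polygons along heptagons of K_9.  Taking for the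
   vertices the projective line over F_8, the heptagons form a single orbit of
   the affine group AGL(1,8), of order 56, that of (oo, 0, w, w+w^2, w+w^2+1,
   w+1, 1) with w^3 = w + 1; it is stabilised by z |-> z + 1.  Two facts about
   this orbit, found by a computer search, are what matters: no path of length
   2 of K_9 lies in two heptagons, so common boundary paths have at most
   5 < 35/6 edges; and the heptagons form a Z-basis of the cycles of K_9.  For
   the latter, a cycle is determined by its values on the 28 edges that avoid
   oo, and the square matrix of the heptagons on these edges is inverted
   explicitly. *)

Set Implicit Arguments.
Unset Strict Implicit.
Unset Printing Implicit Defensive.

Import GRing.Theory.

(** * Finite checks by enumeration *)

(** An enumeration that [vm_compute] can evaluate, turning statements over ordinals into boolean
    tests. *)
Definition ords n : seq 'I_n.+1 := [seq inZp i | i <- iota 0 n.+1].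

Lemma mem_ords n (i : 'I_n.+1) : i \in ords n.
Proof. by apply/mapP; exists (val i); rewrite ?mem_iota ?valZpK //=. Qed.

Lemma all_ords n (a : pred 'I_n.+1) : all a (ords n) -> forall i, a i.
Proof. by move=> /allP h i; apply/h/mem_ords. Qed.

Lemma all_iota0 n (a : pred nat) : all a (iota 0 n) -> forall k, k < n -> a k.
Proof. by move=> /allP h k lt_kn; apply: h; rewrite mem_iota. Qed.

(** * The subdivided graph K_9 *)

(* inl i is the vertex i of K_9.  As 9 is odd, each edge of K_9 is {i, i + d + 1}
   modulo 9 for a unique i and a unique d < 4; its inner points are the
   inr (i, d, k), at distance k + 1 from i. *)
Definition point : finType := ('I_9 + 'I_9 * 'I_4 * 'I_4)%type.

Definition far_end (i : 'I_9) (d : 'I_4) : 'I_9 := (i + inZp d.+1)%R.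

(* The point at distance k <= 5 from i on the subdivided edge from i to j; only
   meaningful when i != j. *)
Definition pt (i j : 'I_9) (k : nat) : point :=
  if k is k'.+1 then
    if k' < 4 then
      let d := (j - i)%R : 'I_9 in
      if d <= 4 then inr (i, inZp d.-1, inZp k')
      else inr (j, inZp (8 - d), inZp (3 - k'))
    else inl j
  else inl i.

Arguments pt : simpl never.

Definition nb (v : point) : seq point :=
  match v with
  | inl i => [seq pt i j 1 | j <- ords 8 & j != i]
  | inr (i, d, k) => [:: pt i (far_end i d) k; pt i (far_end i d) k.+2]
  end.

Definition padj : rel point := fun u v => v \in nb u.

Lemma pt_inr (i : 'I_9) (d k : 'I_4) :
  i != far_end i d /\ pt i (far_end i d) k.+1 = inr (i, d, k).
Proof.
suff h : all (fun i => all (fun d => all (fun k : 'I_4 => (i != far_end i d)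
   && (pt i (far_end i d) k.+1 == inr (i, d, k))) (ords 3)) (ords 3)) (ords 8).
  have /andP[-> /eqP->] := all_ords (all_ords (all_ords h i) d) k; by [].
by vm_compute.
Qed.

Definition all_steps (a : 'I_9 -> 'I_9 -> nat -> bool) : bool :=
  all (fun i => all (fun j => (i == j) || all (a i j) (iota 0 5)) (ords 8))
      (ords 8).

Lemma all_stepsP a : all_steps a -> forall i j k, i != j -> k < 5 -> a i j k.
Proof.
move=> h i j k ne_ij lt_k5; have := all_ords (all_ords h i) j.
by rewrite (negbTE ne_ij) => /all_iota0/(_ _ lt_k5).
Qed.

Lemma pt_step i j k : i != j -> k < 5 ->
  pt i j k != pt i j k.+1 /\ padj (pt i j k) (pt i j k.+1).
Proof.
move=> ne_ij lt_k5; apply/andP.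
suff h : all_steps (fun i j k =>
    (pt i j k != pt i j k.+1) && padj (pt i j k) (pt i j k.+1)).
  exact: (all_stepsP h ne_ij lt_k5).
by vm_compute.
Qed.

Lemma pt_sym i j k : i != j -> k <= 5 -> pt i j k = pt j i (5 - k).
Proof.
move=> ne_ij; rewrite leq_eqVlt => /predU1P[-> //|lt_k5]; apply/eqP.
suff h : all_steps (fun i j k => pt i j k == pt j i (5 - k)).
  exact: (all_stepsP h ne_ij lt_k5).
by vm_compute.
Qed.

(** A left inverse of (i, j, k) |-> ([pt i j k], [pt i j k.+1]), by which a step determines its edge
    of K_9, direction and position; values on other pairs are arbitrary. *)
Definition step_code (u v : point) : 'I_9 * 'I_9 * nat :=
  match u, v with
  | inl i, inl j => (i, j, 0)
  | inl i, inr (i', d, k) => (i, (if i == i' then far_end i' d else i'), 0)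
  | inr (i, d, k), inl j => ((if j == i then far_end i d else i), j, 4)
  | inr (i, d, k), inr (_, _, k') =>
      if k < k' then (i, far_end i d, k.+1) else (far_end i d, i, 4 - k)
  end.

Lemma step_codeK i j k : i != j -> k < 5 ->
  step_code (pt i j k) (pt i j k.+1) = (i, j, k).
Proof.
move=> ne_ij lt_k5.
suff h : all_steps (fun i j k => step_code (pt i j k) (pt i j k.+1) == (i, j, k)).
  exact/eqP/(all_stepsP h ne_ij lt_k5).
by vm_compute.
Qed.

Lemma padjP u v : padj u v ->
  exists i j k, [/\ i != j, k < 5, u = pt i j k & v = pt i j k.+1].
Proof.
case: u => [i /mapP[j] | [[i d] k]].
  by rewrite mem_filter eq_sym => /andP[ne_ij _] ->; exists i, j, 0.
have [ne_ij def_u] := pt_inr i d k; have lt_k4 := ltn_ord k.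
rewrite -{2}def_u /padj [nb _]/= !inE => /orP[] /eqP->; last first.
  by exists i, (far_end i d), k.+1.
(* The step towards i is read from the other end, which is at distance 4 - k from
   [pt i (far_end i d) k.+1]. *)
exists (far_end i d), i, (4 - k); split; rewrite 1?eq_sym //; first by lia.
  by rewrite (pt_sym (k := k.+1) ne_ij) ?subSS //; lia.
by rewrite -subSn ?(ltnW lt_k4) // (pt_sym (k := k) ne_ij) //; lia.
Qed.

Lemma padj_sym : symmetric padj.
Proof.
suff h u v : padj u v -> padj v u by move=> u v; apply/idP/idP; apply: h.
move=> /padjP[i [j [k [ne_ij lt_k5 -> ->]]]].
have lt4k : 4 - k < 5 by lia.
rewrite (pt_sym ne_ij lt_k5) subSS (pt_sym ne_ij (ltnW lt_k5)).
have -> : 5 - k = (4 - k).+1 by lia.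
by rewrite eq_sym in ne_ij; case: (pt_step ne_ij lt4k).
Qed.

Lemma padj_irr : irreflexive padj.
Proof.
move=> u; apply/negP => /padjP[i [j [k [ne_ij lt_k5 -> /eqP]]]].
by case: (pt_step ne_ij lt_k5) => /negP.
Qed.

(** * The 28 heptagons and their subdivisions *)

(* The element w^i of F_8 is written i, for i < 7, while 0 and oo are written 7
   and 8; multiplication by w is then rotation, under which the orbit of
   heptagons splits into four orbits of size 7. *)
Definition base_cycles : seq (seq nat) :=
  [:: [:: 8; 0; 1; 2; 7; 4; 6]; [:: 8; 0; 2; 6; 1; 3; 4];
      [:: 8; 0; 3; 5; 4; 1; 7]; [:: 8; 0; 4; 3; 6; 7; 5]].

Definition rotate (m x : nat) : nat := if x < 7 then (x + m) %% 7 else x.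

(* rotate reduces modulo 7, so that rotate P is the rotation by P %% 7. *)
Definition heptagon (P : 'I_28) : seq 'I_9 :=
  [seq inZp (rotate P x) | x <- nth [::] base_cycles (P %/ 7)].

Definition subdivided (c : seq 'I_9) : seq point :=
  flatten [seq [seq pt x (next c x) k | k <- iota 0 5] | x <- c].

Definition boundary (P : 'I_28) : seq point := subdivided (heptagon P).

Lemma boundary_size_cycle P :
  (size (boundary P) == 35) && graph_cycle padj (boundary P).
Proof.
by move: P; apply: all_ords; vm_compute.
Qed.

Lemma boundary_cycle P : graph_cycle padj (boundary P).
Proof. by case/andP: (boundary_size_cycle P). Qed.

Definition K28 : polygonal_complex :=
  PolygonalComplex padj_sym padj_irr boundary_cycle.

(** * Girth *)

(* Non-backtracking search, from x and arriving from u, for a return to s.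
   Conditionals replace the boolean connectives, both of whose arguments would
   be evaluated by vm_compute. *)
Fixpoint no_return (s u x : point) n : bool :=
  if n is n'.+1 then
    all (fun y => if y == u then true
                  else if y == s then false else no_return s x y n') (nb x)
  else true.

(** A cycle s, x, p has no repetition, so it never backtracks and the search follows it; its length
    is [size p] + 2. The last hypothesis excludes backtracking at the first step. *)
Lemma no_return_path s u x n p :
  no_return s u x n -> path padj x (rcons p s) -> uniq (s :: x :: p) ->
  head s p != u -> n <= size p.
Proof.
elim: p u x n => [|y p IH] u x [|n] //= /allP nr.
  by rewrite andbT => /nr; rewrite eqxx; case: (s =P u).
move=> /andP[/nr + pth]; rewrite !inE !negb_or -!andbA.
move=> + /and5P[ne_sx ne_sy s_p ne_xy /and3P[x_p y_p u_p]] ne_yu.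
rewrite (negbTE ne_yu) eq_sym (negbTE ne_sy) => nr'; apply: (IH x y) => //=.
  by rewrite !inE negb_or ne_sy s_p y_p.
by case: (p) x_p => //= z q; rewrite inE negb_or eq_sym => /andP[].
Qed.

Lemma cycle_rot c x : graph_cycle padj c -> x \in c ->
  exists p, graph_cycle padj (x :: p) /\ size c = (size p).+1 /\ x :: p =i c.
Proof.
move=> /and3P[sz cyc unq] /rot_to[n p def_p]; exists p.
rewrite /graph_cycle -def_p rot_cycle rot_uniq cyc unq size_rot sz.
by split=> //; rewrite -(size_rot n) def_p; split=> // y; rewrite -def_p mem_rot.
Qed.

(** The neighbours of an inner point along the cycle are distinct, and it has only two neighbours in
    the graph, so both lie on the cycle. *)
Lemma cycle_inner c i d k : graph_cycle padj c -> inr (i, d, k) \in c ->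
  pt i (far_end i d) k \in c.
Proof.
move=> cyc /(cycle_rot cyc)[[|x p] [/and3P[// + cyc' unq] [_ <-]]].
case: p cyc' unq => // y p cyc' /and3P[_ x_p _] _.
set u := inr (i, d, k) in cyc' *.
have /andP[ux pth] : padj u x && path padj x (rcons (y :: p) u) by [].
have lu : padj u (last x (y :: p)).
  by rewrite padj_sym; move: pth; rewrite rcons_path => /andP[].
have lst : last x (y :: p) \in y :: p by rewrite /= mem_last.
have ne_lx : last x (y :: p) != x by apply: contra x_p => /eqP <-.
move: ux lu; rewrite /padj [nb _]/= !inE => /orP[/eqP <-|/eqP def_x].
  by rewrite eqxx orbT.
case/orP=> /eqP def_l.
  by rewrite def_l !inE in lst; rewrite lst !orbT.
by rewrite def_l def_x eqxx in ne_lx.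
Qed.

(** By descent: with an inner point the cycle contains the preceding point of the segment, down to
    the end i. *)
Lemma cycle_base c : graph_cycle padj c -> exists i, inl i \in c.
Proof.
move=> cyc; have /and3P[sz _ _] := cyc.
have : has predT c by case: (c) sz.
case/hasP=> [[i ci _|[[i d] [k lt_k4]] c_u _]]; first by exists i.
exists i; have [ne_i _] := pt_inr i d (Ordinal lt_k4).
elim: k lt_k4 c_u {ne_i} => [|k IH] lt_k4 c_u; first exact: cycle_inner cyc c_u.
have lt_k := ltnW lt_k4; apply: (IH lt_k).
have [_ <-] := pt_inr i d (Ordinal lt_k).
exact: cycle_inner cyc c_u.
Qed.

Lemma girth15 : is_girth padj 15.
Proof.
split.
  (* The subdivided triangle 0, 1, 2. *)
  exists (subdivided [:: inZp 0; inZp 1; inZp 2]); split; last by [].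
  by vm_compute.
(* No return within 13 steps after the first edge puts 13 further vertices on the cycle, hence 15 in
   all. *)
have nr i x : padj (inl i) x -> no_return (inl i) (inl i) x 13.
  move: x; apply/allP; move: i; apply: all_ords.
  by vm_compute.
move=> c cyc; have [i /(cycle_rot cyc)[p [cyc' [-> _]]]] := cycle_base cyc.
case: p cyc' => [|x [|y p]] // /and3P[_ cyc' unq].
have /andP[adj_x pth] : padj (inl i) x && path padj x (rcons (y :: p) (inl i)).
  by [].
apply: (no_return_path (nr i x adj_x) pth unq) => /=.
rewrite eq_sym; case/andP: unq; rewrite !inE !negb_or.
by case/and3P.
Qed.

(** * Distances between branch vertices *)

Fixpoint walk_ends (x : point) n : seq point :=
  if n is n'.+1 then flatten [seq walk_ends y n' | y <- nb x] else [:: x].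

Lemma walk_ends_path x p : path padj x p -> last x p \in walk_ends x (size p).
Proof.
elim: p x => [|y p IH] x /=; first by rewrite inE.
move=> /andP[adj_xy /IH yp]; apply/flattenP.
by exists (walk_ends y (size p)) => //; apply/mapP; exists y.
Qed.

Lemma valence3 x : 2 < valence padj x -> exists i, x = inl i.
Proof.
case: x => [i _|[[i d] k]]; first by exists i.
suff le2 : valence padj (inr (i, d, k)) <= 2 by rewrite ltnNge le2.
rewrite /valence (@eq_card _ _ (mem (nb (inr (i, d, k))))); first exact: card_size.
by move=> y; rewrite inE.
Qed.

Lemma branch_dist (x y : point) (p : seq point) :
  x != y -> 2 < valence padj x -> 2 < valence padj y ->
  path padj x p -> last x p = y -> 4 < size p.
Proof.
move=> + /valence3[i def_x] /valence3[j def_y] /walk_ends_path + lst.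
rewrite {}lst {x}def_x {y}def_y ltnNge => + ye; apply: contra => le_p4.
(* All walks of at most 4 edges from a vertex of K_9 are enumerated; none ends at another such
   vertex. *)
suff h : all (fun i => all (fun n => all (fun y : point =>
  if y is inl j then j == i else true) (walk_ends (inl i) n)) (iota 0 5)) (ords 8).
  by have /all_iota0/(_ _ le_p4)/allP/(_ _ ye)/eqP-> := all_ords h i.
by vm_compute.
Qed.

(** * Polygon boundaries along subdivided edges *)

Definition base_step (P : 'I_28) (i j : 'I_9) : bool :=
  (i \in heptagon P) && (next (heptagon P) i == j).

Lemma next_boundary P i j k : base_step P i j -> k < 5 ->
  [/\ i != j, pt i j k \in boundary P & next (boundary P) (pt i j k) = pt i j k.+1].
Proof.
move=> /andP[i_c /eqP<-] lt_k5.
pose ok P := let b := boundary P in let c := heptagon P in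
  all (fun i => let j := next c i in
    (i != j) && all (fun k => next b (pt i j k) == pt i j k.+1) (iota 0 5)) c.
have okP Q : ok Q by move: Q; apply: all_ords; vm_compute.
have /allP/(_ i i_c)/andP[ne_ij /all_iota0/(_ _ lt_k5)/eqP nxt] := okP P.
split=> //; apply/flattenP.
exists [seq pt i (next (heptagon P) i) k | k <- iota 0 5]; apply/mapP.
  by exists i.
by exists k => //; rewrite mem_iota.
Qed.

Lemma bd_step_pt (P : polygon K28) i j k : i != j -> k < 5 ->
  @bd_step K28 P (pt i j k) (pt i j k.+1) = base_step P i j.
Proof.
move=> ne_ij lt_k5; apply/idP/idP; last first.
  by move=> /next_boundary/(_ lt_k5)[_ mem_b nxt]; rewrite /bd_step /= mem_b nxt eqxx.
rewrite /bd_step /= => /andP[/flattenP[s /mapP[x x_c ->] /mapP[l]]].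
rewrite mem_iota => lt_l5 def_pt.
have st : base_step P x (next (heptagon P) x) by rewrite /base_step x_c eqxx.
have [ne_x _ nxt] := next_boundary st lt_l5.
rewrite def_pt nxt => /eqP def_pt'.
(* The given step equals one taken from the heptagon, so [step_code] identifies their edges of
   K_9. *)
have := step_codeK ne_ij lt_k5; rewrite def_pt -def_pt' step_codeK // => -[<- <- _].
exact: st.
Qed.

Lemma bd_step_ptr (P : polygon K28) i j k : i != j -> k < 5 ->
  @bd_step K28 P (pt i j k.+1) (pt i j k) = base_step P j i.
Proof.
move=> ne_ij lt_k5; have lt4k : 4 - k < 5 by lia.
rewrite (pt_sym ne_ij lt_k5) subSS (pt_sym ne_ij (ltnW lt_k5)).
have -> : 5 - k = (4 - k).+1 by lia.
by rewrite bd_step_pt // eq_sym.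
Qed.

Lemma bd_step_adj (P : polygon K28) (u v : point) :
  @bd_step K28 P u v -> padj u v.
Proof.
move=> /andP[u_b /eqP<-]; have /and3P[_ cyc _] := boundary_cycle P.
exact: next_cycle cyc u_b.
Qed.

(** * Intersections of two polygons *)

Definition base_edge P i j := base_step P i j || base_step P j i.

Lemma base_edge_sym P i j : base_edge P i j = base_edge P j i.
Proof. exact: orbC. Qed.

Lemma uniq_heptagon P : uniq (heptagon P).
Proof. by move: P; apply: all_ords; vm_compute. Qed.

Definition turn (P : 'I_28) (i : 'I_9) : seq 'I_9 :=
  [:: next (heptagon P) i; prev (heptagon P) i].

Lemma base_edgeP P i j : base_edge P i j -> i \in heptagon P /\ j \in turn P i.
Proof.
rewrite /base_edge /base_step !inE => /orP[] /andP[mem /eqP<-].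
  by rewrite eqxx.
by rewrite mem_next mem prev_next ?uniq_heptagon // eqxx orbT.
Qed.

(** No path of length 2 of K_9 lies in two heptagons: if i were its middle, its ends would be the
    two neighbours of i in both. *)
Lemma turn_sep P Q i : P != Q -> i \in heptagon P -> i \in heptagon Q ->
  ~~ all (mem (turn Q i)) (turn P i).
Proof.
pose ok P := let c := heptagon P in all (fun Q => if P == Q then true else
  let c' := heptagon Q in all (fun i => if i \in c' then
    ~~ all (mem (turn Q i)) (turn P i) else true) c) (ords 27).
have okP R : ok R by move: R; apply: all_ords; vm_compute.
move=> ne_PQ iP iQ; have := all_ords (okP P) Q; rewrite (negbTE ne_PQ).
by move=> /allP/(_ i iP); rewrite iQ.
Qed.

(** Two different common edges at i would form a common path of length 2, against [turn_sep]. *)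
Lemma common_base_edge_uniq P Q i j j' : P != Q ->
  base_edge P i j -> base_edge Q i j ->
  base_edge P i j' -> base_edge Q i j' -> j = j'.
Proof.
move=> ne_PQ /base_edgeP[iP jP] /base_edgeP[iQ jQ].
move=> /base_edgeP[_ j'P] /base_edgeP[_ j'Q].
apply/eqP; have := turn_sep ne_PQ iP iQ; apply: contraR => ne_jj'.
suff tP l : l \in turn P i -> l = j \/ l = j' by apply/allP => l /tP[]->.
move: jP j'P; rewrite !inE => /orP[]/eqP dj /orP[]/eqP dj'.
- by rewrite dj dj' eqxx in ne_jj'.
- by rewrite -dj -dj' => /orP[]/eqP; [left | right].
- by rewrite -dj -dj' => /orP[]/eqP; [right | left].
by rewrite dj dj' eqxx in ne_jj'.
Qed.

Lemma bd_edge_pt (P : polygon K28) i j k : i != j -> k < 5 ->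
  @bd_edge K28 P (pt i j k) (pt i j k.+1) = base_edge P i j.
Proof. by move=> ne_ij lt_k5; rewrite /bd_edge bd_step_pt ?bd_step_ptr. Qed.

Lemma bd_edge_adj (P : polygon K28) u v : @bd_edge K28 P u v -> padj u v.
Proof. by case/orP => /bd_step_adj //; rewrite padj_sym. Qed.

Lemma common_edgeP (P Q : polygon K28) u v : @common_edge K28 P Q u v ->
  exists i j k, [/\ i != j, k < 5, u = pt i j k, v = pt i j k.+1 &
                    base_edge P i j /\ base_edge Q i j].
Proof.
case/andP=> eP eQ.
have [i [j [k [ne_ij lt_k5 def_u def_v]]]] := padjP (bd_edge_adj eP).
exists i, j, k; split=> //; move: eP eQ.
by rewrite def_u def_v !bd_edge_pt.
Qed.

(** The order depends on the end from which [point] parametrises the edge. *)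
Lemma nb_inner i j k : i != j -> k < 4 ->
  nb (pt i j k.+1) = [:: pt i j k; pt i j k.+2] \/
  nb (pt i j k.+1) = [:: pt i j k.+2; pt i j k].
Proof.
move=> ne_ij lt_k4;
suff h : all_steps (fun i j k => (3 < k) || let u := pt i j k in
    let v := pt i j k.+2 in nb (pt i j k.+1) \in [:: [:: u; v]; [:: v; u]]).
  have := all_stepsP h ne_ij (ltnW lt_k4).
  by rewrite leqNgt lt_k4 /= !inE => /orP[]/eqP; [left | right].
by vm_compute.
Qed.

Lemma pt_inl i j k a : k < 5 -> pt i j k = inl a -> k = 0 /\ i = a.
Proof.
case: k => [|k] lt_k5; first by case.
by rewrite /pt ltnS in lt_k5 *; rewrite lt_k5; case: ifP.
Qed.

(** The common boundary cannot leave a common subdivided edge: inner points have no other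
    neighbours, and at the ends [common_base_edge_uniq] forbids a second edge of K_9. *)
Lemma common_edge_segment (P Q : polygon K28) i j k u : P != Q -> i != j ->
  base_edge P i j -> base_edge Q i j -> k <= 5 ->
  @common_edge K28 P Q (pt i j k) u ->
  exists l, [/\ l < 5, [set pt i j k; u] = [set pt i j l; pt i j l.+1] &
     u = pt i j l \/ u = pt i j l.+1].
Proof.
move=> ne_PQ ne_ij eP eQ le_k5 ce.
have [i' [j' [k' [ne' lt_k' def_v def_u [eP' eQ']]]]] := common_edgeP ce.
have [k0|k_gt0] := posnP k.
  have [k'0 i'i] : k' = 0 /\ i' = i.
    by apply: (pt_inl (j := j') lt_k'); rewrite -def_v k0.
  rewrite {}i'i {}k'0 {}k0 in eP' eQ' def_u def_v *.
  have j'j := common_base_edge_uniq ne_PQ eP' eQ' eP eQ.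
  by exists 0; rewrite def_u j'j; split=> //; right.
(* The far end is the origin of the reversed edge, whose first step is the step l = 4 here. *)
have [k5|lt_k5] := eqVneq k 5.
  have [k'0 i'j] : k' = 0 /\ i' = j.
    by apply: (pt_inl (j := j') lt_k'); rewrite -def_v k5.
  rewrite {}i'j {}k'0 {}k5 in eP' eQ' def_u def_v *.
  rewrite base_edge_sym in eP; rewrite base_edge_sym in eQ.
  have j'i := common_base_edge_uniq ne_PQ eP' eQ' eP eQ.
  rewrite j'i in def_u; rewrite eq_sym in ne_ij.
  by exists 4; rewrite def_u (pt_sym ne_ij) // setUC; split=> //; left.
case: k k_gt0 lt_k5 le_k5 ce {def_v} => // k _ ne_k5 le_k5 /andP[/bd_edge_adj ad _].
have lt_k4 : k < 4 by lia.
have [->|->] : u = pt i j k \/ u = pt i j k.+2.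
  by move: ad; rewrite /padj; case: (nb_inner ne_ij lt_k4) => ->;
     rewrite !inE => /orP[]/eqP->; [left|right|right|left].
  by exists k; rewrite setUC; split; [lia| |left].
by exists k.+1; split=> //; right.
Qed.

Lemma component_small (P Q : polygon K28) (x : point) : P != Q ->
  #|@component_edges K28 P Q x| <= 5.
Proof.
(* If no common edge leaves x, its component has no edges; otherwise it stays within one subdivided
   edge, which has 5. *)
move=> ne_PQ; case: (pickP (@common_edge K28 P Q x)) => [y|] ce; last first.
  rewrite (_ : component_edges _ _ _ = set0) ?cards0 //.
  apply/setP => e; rewrite inE; apply/imsetP => -[[u v]].
  rewrite inE /= => /andP[/connectP[p pth ->]].
  by case: p pth => [_|z p /=]; rewrite /= ce.
have [i [j [k [ne_ij lt_k5 def_x _ [eP eQ]]]]] := common_edgeP ce.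
have conn u : connect (@common_edge K28 P Q) x u -> exists2 l, l <= 5 & u = pt i j l.
  case/connectP=> p pth ->; have le_k5 := ltnW lt_k5.
  elim: p x k pth def_x le_k5 {ce lt_k5} => [|z p IH] x k /=.
    by move=> _ -> le_k5; exists k.
  case/andP=> ce pth def_x le_k5; rewrite def_x in ce.
  have [l [lt_l5 _ def_z]] := common_edge_segment ne_PQ ne_ij eP eQ le_k5 ce.
  by case: def_z => def_z; apply: IH pth def_z _; lia.
suff sub : @component_edges K28 P Q x \subset
    [set [set pt i j (val l); pt i j (val l).+1] | l : 'I_5].
  apply: leq_trans (subset_leq_card sub) _.
  by apply: leq_trans (leq_imset_card _ _) _; rewrite card_ord.
apply/subsetP => e /imsetP[[u v]]; rewrite inE /= => /andP[/conn[l le_l5 ->] ce'] ->.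
have [m [lt_m5 -> _]] := common_edge_segment ne_PQ ne_ij eP eQ le_l5 ce'.
by apply/imsetP; exists (Ordinal lt_m5).
Qed.

Local Open Scope ring_scope.

(** * H_0 of a connected complex *)

Section ConnectedH0.
Variable K : polygonal_complex.
Local Notation V := (vertex K).

Definition augmentation (c : chain0 K) : int := \sum_x c x.

Lemma augmentation_is_nmod_morphism : nmod_morphism augmentation.
Proof.
split=> [|c c']; first by apply: big1 => x _; rewrite ffunE.
by rewrite /augmentation -big_split; apply: eq_bigr => x _; rewrite ffunE.
Qed.

HB.instance Definition _ :=
  GRing.isNmodMorphism.Build (chain0 K) int augmentation
    augmentation_is_nmod_morphism.

Lemma augmentation_boundary c : is_boundary0 c -> augmentation c = 0.
Proof.
case=> f [asym _] <-; set s := augmentation _.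
(* Exchanging the two sums turns the antisymmetry of f into s = -s, and [int] has no 2-torsion. *)
suff : s = - s by lia.
rewrite {1}/s /augmentation (eq_bigr (fun y => \sum_x f (x, y))); last first.
  by move=> y _; rewrite ffunE.
rewrite exchange_big /s /augmentation -sumrN; apply: eq_bigr => x _.
by rewrite ffunE -sumrN; apply: eq_bigr => y _.
Qed.

Definition point_chain (v : V) : chain0 K := [ffun w => (w == v)%:R].

Lemma is_boundary0_comb (c c' : chain0 K) (m : int) :
  is_boundary0 c -> is_boundary0 c' ->
  is_boundary0 (c + [ffun v => m * c' v]).
Proof.
move=> [f [fa f0] <-] [g [ga g0] <-].
exists [ffun u => f u + m * g u]; last first.
  apply/ffunP => y; rewrite !ffunE mulr_sumr -big_split.
  by apply: eq_bigr => x _; rewrite ffunE.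
split=> [x y|x y nxy]; rewrite !ffunE.
  by rewrite fa ga; ring.
by rewrite f0 ?g0 ?mulr0.
Qed.

Lemma is_boundary0_0 : is_boundary0 (0 : chain0 K).
Proof.
exists 0; first by split=> *; rewrite !ffunE ?oppr0.
by apply/ffunP => y; rewrite !ffunE big1 // => x _; rewrite ffunE.
Qed.

Lemma is_boundary0_edge u v :
  adj u v -> is_boundary0 (point_chain v - point_chain u).
Proof.
move=> uv; exists [ffun w => (w == (u, v))%:R - (w == (v, u))%:R].
  split=> x y; rewrite !ffunE.
    by rewrite !xpair_eqE opprB andbC (andbC (x == v)).
  move=> nxy; have [[xu yv]|_] := (x, y) =P (u, v); first by rewrite xu yv uv in nxy.
  have [[xv yu]|_] := (x, y) =P (v, u); first by rewrite xv yu adj_sym uv in nxy.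
  by rewrite subrr.
apply/ffunP => y; rewrite !ffunE.
rewrite (eq_bigr (fun x => (x == u)%:R * (y == v)%:R - (x == v)%:R * (y == u)%:R)).
  have sum1 w : \sum_(x : V) (x == w)%:R = 1 :> int.
    by rewrite (bigD1 w) //= eqxx big1 ?addr0 // => x /negbTE->.
  by rewrite sumrB -!mulr_suml !sum1 !mul1r.
by move=> x _; rewrite ffunE !xpair_eqE -!natrM !mulnb.
Qed.

Lemma is_boundary0_connect u v :
  connect (@adj K) u v -> is_boundary0 (point_chain v - point_chain u).
Proof.
case/connectP=> p pth ->; elim: p u pth => [|w p IH] u /=.
  by rewrite subrr => _; exact: is_boundary0_0.
case/andP=> /is_boundary0_edge bu /IH bw.
have := is_boundary0_comb 1 bw bu; congr is_boundary0.
by apply/ffunP => y; rewrite !ffunE; ring.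
Qed.

Lemma H0_connected (r : V) : (forall v, connect (@adj K) r v) ->
  exists phi : {additive chain0 K -> int},
    (forall m : int, exists c, phi c = m) /\
    (forall c, phi c = 0 <-> is_boundary0 c).
Proof.
move=> conn; exists augmentation; split=> [m|c].
  exists [ffun x => if x == r then m else 0].
  rewrite /= /augmentation (bigD1 r) //= ffunE eqxx big1 ?addr0 // => x.
  by rewrite ffunE => /negbTE->.
split=> [c0|]; last exact: augmentation_boundary.
(* When the coefficients sum to 0, c is the sum of the c v (v - r), each a boundary by
   connectedness. *)
have -> : c = \sum_v [ffun w => c v * (point_chain v - point_chain r) w].
  apply/ffunP => w; rewrite sum_ffunE.
  rewrite (eq_bigr (fun v => c v * (w == v)%:R - c v * (w == r)%:R)).
    rewrite sumrB -mulr_suml [\sum_i c i]c0 mul0r subr0 (bigD1 w) //= eqxx mulr1.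
    by rewrite big1 ?addr0 // => v; rewrite eq_sym => /negbTE->; rewrite mulr0.
  by move=> v _; rewrite !ffunE; ring.
elim/big_rec: _ => [|v c' _ bc']; first exact: is_boundary0_0.
by rewrite addrC; apply: is_boundary0_comb bc' (is_boundary0_connect (conn v)).
Qed.

End ConnectedH0.

(** * The incidence matrix and H_2 *)

Lemma uniq_ords n : uniq (ords n).
Proof.
rewrite map_inj_in_uniq ?iota_uniq // => i j.
rewrite !mem_iota /= => lt_i lt_j /(congr1 val) /=.
by rewrite !modn_small.
Qed.

Lemma big_ords n (P : pred 'I_n.+1) (F : 'I_n.+1 -> int) :
  \sum_(i <- ords n | P i) F i = \sum_(i | P i) F i.
Proof.
rewrite -big_filter -[RHS]big_filter; apply/perm_big/uniq_perm.
- by rewrite filter_uniq ?uniq_ords.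
- by rewrite filter_uniq ?index_enum_uniq.
by move=> i; rewrite !mem_filter mem_ords mem_index_enum.
Qed.

(** Sums over ordinals pass through this list recursion to be evaluated by [vm_compute]. *)
Definition dot (s t : seq int) : int :=
  foldr (fun u x => u.1 * u.2 + x) 0 (zip s t).

Lemma dotE n (F G : 'I_n.+1 -> int) :
  dot [seq F i | i <- ords n] [seq G i | i <- ords n] = \sum_i F i * G i.
Proof.
rewrite -big_ords /dot; elim: (ords n) => [|i s IH] /=; first by rewrite big_nil.
by rewrite big_cons IH.
Qed.

Definition incidence (P : 'I_28) (i j : 'I_9) : int :=
  (base_step P i j)%:R - (base_step P j i)%:R.

Lemma incidence_sum P i : \sum_(j | j != i) incidence P i j = 0.
Proof.
have -> : \sum_(j | j != i) incidence P i j = \sum_j incidence P i j * 1.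
  rewrite [RHS](bigD1 i) //= /incidence subrr mul0r add0r.
  by apply: eq_bigr => j _; rewrite mulr1.
rewrite -dotE; apply/eqP; move: i; apply: all_ords; move: P; apply: all_ords.
by vm_compute.
Qed.

(* The edges of K_9 off the spanning star with centre oo = 8, oriented. *)
Definition chord (e : 'I_28) : 'I_9 * 'I_9 :=
  (inZp (e %% 7), inZp (rotate e (nth 0%N [:: 1; 2; 3; 7] (e %/ 7)))).

Lemma chord_cover i j : i != j -> i != inZp 8 -> j != inZp 8 ->
  exists e, chord e = (i, j) \/ chord e = (j, i).
Proof.
suff /hasP[e _ ch] : has (fun e => [|| i == j, i == inZp 8, j == inZp 8,
    chord e == (i, j) | chord e == (j, i)]) (ords 27).
  move=> /negbTE ij /negbTE i8 /negbTE j8; exists e; move: ch.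
  by rewrite ij i8 j8 /= => /orP[]/eqP; [left | right].
move: j; apply: all_ords; move: i; apply: all_ords; by vm_compute.
Qed.

(* One row of the inverse for each orbit of chords under rotation. *)
Definition inverse_rows : seq (seq int) := [::
 [:: 0;  0;  1;  1; -1; -1;  0;  0; -1;  1;  0;  0;  0;  0;
    -1;  0;  0; -1;  0;  1;  1;  1;  0; -1; -1;  0;  0;  0];
 [:: 1;  1;  0;  0;  0;  0; -1;  0;  1; -1;  0;  1; -1;  0;
     1; -1; -1;  1;  0;  0;  0;  0;  0;  0;  0;  0;  1;  1];
 [:: 1;  0;  1;  1;  0;  0;  0; -1;  0;  0;  0;  0; -1;  1;
     0;  0;  0;  0; -1;  1;  0;  1;  1;  0;  0;  1;  1;  1];
 [:: 0; -1; -1;  0;  0;  1;  0;  0;  0;  0; -1;  1; -1;  1;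
     0;  1;  0;  1; -1;  0;  0; -1;  0;  0;  0;  0; -1; -1]].

Definition chord_mx : 'M[int]_28 :=
  \matrix_(P, e) incidence P (chord e).1 (chord e).2.

(** Rotation invariance: within a block the entry depends only on P - e modulo 7; adding
    [7 - e %% 7] avoids truncated subtraction. *)
Definition inverse_entry (e P : 'I_28) : int :=
  nth 0 (nth [::] inverse_rows (e %/ 7)) (7 * (P %/ 7) + (P + (7 - e %% 7)) %% 7).

Definition inverse_mx : 'M[int]_28 := \matrix_(e, P) inverse_entry e P.

Lemma chord_mxV : chord_mx *m inverse_mx = 1%:M.
Proof.
apply/matrixP => P Q; rewrite !mxE.
under eq_bigr do rewrite !mxE.
rewrite -dotE; apply/eqP; move: Q.
pose ok P := let row := [seq incidence P (chord e).1 (chord e).2 | e <- ords 27] in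
  all (fun Q => dot row [seq inverse_entry e Q | e <- ords 27] == (P == Q)%:R)
      (ords 27).
suff okP : ok P by exact: (all_ords okP).
by move: P; apply: all_ords; vm_compute.
Qed.

Lemma d2_pt (a : chain2 K28) i j k : i != j -> (k < 5)%N ->
  d2 a (pt i j k, pt i j k.+1) = \sum_P a P * incidence P i j.
Proof.
move=> ne_ij lt_k5; rewrite ffunE; apply: eq_bigr => P _ /=.
by rewrite bd_step_pt // bd_step_ptr.
Qed.

(** One edge per subdivided chord suffices to recover a, as [chord_mx] is invertible. *)
Lemma d2_chord (a : chain2 K28) :
  (\row_P a P) *m chord_mx =
  \row_e d2 a (pt (chord e).1 (chord e).2 0, pt (chord e).1 (chord e).2 1).
Proof.
apply/rowP => e; rewrite !mxE d2_pt //.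
  by apply: eq_bigr => P _; rewrite !mxE.
by move: e; apply: all_ords; vm_compute.
Qed.

Lemma d2_inj (a : chain2 K28) : d2 a = 0 -> a = 0.
Proof.
move=> a0; have := d2_chord a; rewrite a0.
move=> /(congr1 (mulmx^~ inverse_mx)); rewrite -mulmxA chord_mxV mulmx1.
move=> /rowP ha; apply/ffunP => P; have := ha P; rewrite !mxE => ->.
by rewrite big1 ?ffunE // => e _; rewrite !mxE ffunE mul0r.
Qed.

(** * H_1: every cycle is a boundary *)

Section Cycles.
Variable f : {ffun point * point -> int}.
Hypotheses (f_chain : is_chain1 (K := K28) f) (f_cycle : d1 (K := K28) f = 0).

Lemma uniq_nb y : uniq (nb y).
Proof.
case: y => [i|[[i d] k]].
  by move: i; apply: all_ords; vm_compute.
move: k; apply: all_ords; move: d; apply: all_ords; move: i; apply: all_ords.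
by vm_compute.
Qed.

Lemma cycle_nb y : \sum_(x <- nb y) f (x, y) = 0.
Proof.
have := f_cycle => /ffunP/(_ y); rewrite !ffunE => f0.
rewrite big_uniq ?uniq_nb // -[RHS]f0 [RHS](bigID (mem (nb y))) /=.
rewrite [X in _ + X]big1 ?addr0 //.
by move=> x nyx; case: f_chain => _; apply => /=; rewrite padj_sym.
Qed.

Definition flow i j := f (pt i j 0, pt i j 1).

(** Conservation at an inner point, which has two neighbours, makes a cycle constant along the
    subdivided edge. *)
Lemma flow_const i j k : i != j -> (k < 5)%N -> f (pt i j k, pt i j k.+1) = flow i j.
Proof.
move=> ne_ij; elim: k => [//|k IH] lt_k5; rewrite -IH 1?ltnW //.
have := cycle_nb (pt i j k.+1); have [fa _] := f_chain.
have [->|->] := nb_inner ne_ij lt_k5;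
  rewrite !big_cons big_nil [f (pt i j k.+2, _)]fa addr0 1?[- _ + _]addrC;
  by move/eqP; rewrite subr_eq0 => /eqP.
Qed.

Lemma flow_anti i j : i != j -> flow j i = - flow i j.
Proof.
move=> ne_ij; rewrite -(flow_const (k := 4) ne_ij) //.
have [fa _] := f_chain; rewrite -fa; rewrite eq_sym in ne_ij.
by rewrite /flow (pt_sym (k := 0) ne_ij) // (pt_sym (k := 1) ne_ij).
Qed.

Lemma flow_sum i : \sum_(j | j != i) flow i j = 0.
Proof.
have := cycle_nb (inl i); rewrite big_map big_filter big_ords => h.
apply/eqP; rewrite -oppr_eq0 -sumrN -[X in _ == X]h; apply/eqP/eq_bigr => j ne.
by have [fa _] := f_chain; rewrite /flow -fa.
Qed.

(** The coefficients a are solved from the chords; the remainder h is a cycle of K_9 vanishing on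
    the chords, hence also on the star at oo. *)
Lemma cycle_is_boundary : exists a : chain2 K28, d2 a = f.
Proof.
pose g := \row_e flow (chord e).1 (chord e).2.
pose a : chain2 K28 := [ffun P => (g *m inverse_mx) 0 P].
pose h i j := flow i j - \sum_P a P * incidence P i j.
have h_anti i j : i != j -> h j i = - h i j.
  move=> ne_ij; rewrite /h flow_anti // opprB addrC; congr (_ + _).
  rewrite -sumrN; apply: eq_bigr => P _; rewrite /incidence; ring.
have h_sum i : \sum_(j | j != i) h i j = 0.
  rewrite sumrB flow_sum exchange_big big1 ?subrr // => P _.
  by rewrite -mulr_sumr incidence_sum mulr0.
have h_chord e : h (chord e).1 (chord e).2 = 0.
  have /rowP/(_ e) : g = (\row_P a P) *m chord_mx.
    have -> : \row_P a P = g *m inverse_mx.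
      by apply/rowP => P; rewrite !mxE ffunE mxE.
    (* A right inverse of a square matrix is also a left inverse. *)
    by rewrite -mulmxA (mulmx1C chord_mxV) mulmx1.
  rewrite !mxE /h => ->; apply/eqP; rewrite subr_eq0; apply/eqP.
  by apply: eq_bigr => P _; rewrite !mxE.
have h_in i j : i != j -> i != inZp 8 -> j != inZp 8 -> h i j = 0.
  move=> ne_ij i8 j8; have [e [] def_e] := chord_cover ne_ij i8 j8.
    by have := h_chord e; rewrite def_e.
  by have := h_chord e; rewrite def_e /= h_anti // => /eqP; rewrite oppr_eq0 => /eqP.
(* Every edge at i but the one to oo is a chord up to orientation, so [h_sum] leaves only that
   term. *)
have h_out i : i != inZp 8 -> h i (inZp 8) = 0.
  move=> i8; have := h_sum i; rewrite (bigD1 (inZp 8)) /=; last by rewrite eq_sym.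
  rewrite big1 ?addr0 // => j /andP[ji j8]; apply: h_in => //; by rewrite eq_sym.
have h0 i j : i != j -> h i j = 0.
  have [->|i8] := eqVneq i (inZp 8); last first.
    by have [->|j8] := eqVneq j (inZp 8) => ij; [apply: h_out | apply: h_in].
  by move=> j8; rewrite h_anti 1?eq_sym // h_out ?oppr0 // eq_sym.
exists a; apply/ffunP => -[u v].
have [uv|nuv] := boolP (padj u v).
  have [i [j [k [ne_ij lt_k5 -> ->]]]] := padjP uv.
  rewrite d2_pt // flow_const //; apply/eqP; rewrite eq_sym -subr_eq0; apply/eqP.
  exact: h0.
case: f_chain => _ /(_ u v nuv) ->; rewrite ffunE big1 // => P _ /=.
have /negbTE-> : ~~ @bd_step K28 P u v by apply: contra nuv => /bd_step_adj.
have /negbTE-> : ~~ @bd_step K28 P v u.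
  by apply: contra nuv => /bd_step_adj; rewrite padj_sym.
by rewrite subrr mulr0.
Qed.

End Cycles.

(** * Connectedness and conclusion *)

Lemma padj_connected v : connect padj (inl (inZp 0)) v.
Proof.
have seg i j k : i != j -> (k <= 5)%N -> connect padj (inl i) (pt i j k).
  move=> ne_ij; elim: k => [_|k IH lt_k5]; first exact: connect0.
  apply: connect_trans (IH (ltnW lt_k5)) (connect1 _).
  by case: (pt_step ne_ij lt_k5).
have base i : connect padj (inl (inZp 0)) (inl i).
  have [->|ne] := eqVneq i (inZp 0); first exact: connect0.
  by rewrite eq_sym in ne; apply: (seg _ _ 5%N ne).
case: v => [//|[[i d] k]]; have [ne_i <-] := pt_inr i d k.
by apply: connect_trans (base i) (seg _ _ _ ne_i _); rewrite ltnS ltnW // ltn_ord.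
Qed.

Lemma acyclic_K28 : acyclic K28.
Proof.
split; first exact: (@H0_connected K28 _ padj_connected).
  exact: cycle_is_boundary.
exact: d2_inj.
Qed.

Lemma perimeter_K28 (P : polygon K28) : perimeter P = 35%N.
Proof. by case/andP: (boundary_size_cycle P) => /eqP. Qed.

Local Close Scope ring_scope.
Theorem mainTheorem4 :
  exists K : polygonal_complex,
    [/\ spectacular K,
        is_girth (@adj K) 15,
        #|polygon K| = 28
      & forall P : polygon K, perimeter P = 35].
Proof.
exists K28; split; [|exact: girth15|exact: card_ord|exact: perimeter_K28].
split; first by rewrite card_ord.
split; first exact: branch_dist.
split.
  (* The perimeter bound reads 2 * 15 < 35. *)
  by exists 15; split=> [||P]; [exact: girth15| |rewrite perimeter_K28].
split; last exact: acyclic_K28.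
move=> P Q x ne_PQ _ _; rewrite !perimeter_K28.
(* A component has at most 5 edges, and 6 * 5 < 35. *)
by have := component_small x ne_PQ; lia.
Qed.
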